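(* Let $(E,\leqslant,\mathfrak{c})$ be an enriched qoset. Let $A\subseteq E$ and $x\in A$. Consider the following assertions: (1) $x$ is a $\mathfrak{c}^{\uparrow}$-extreme point of $A$; (2) $x\in\mathrm{ex}_{\mathfrak{c}}(A\setminus U)$ for some upper subset $U\subseteq E$; (3) $x\in\mathrm{ex}_{\mathfrak{c}}(A\cap\downarrow x)$; (4) $x\in\mathfrak{c}(B)\cap B^{\uparrow}$ implies $x\in[B]$, for all $B\subseteq A$; (5) $x\in B^{\vee}$ implies $x\in[B]$, for all $B\subseteq A$ with a $\mathfrak{c}$-sup; (6) $x\in\mathfrak{c}(F)\cap F^{\uparrow}$ implies $x\in[F]$, for all finite subsets $F\subseteq A$; (7) $x\in F^{\vee}$ implies $x\in[F]$, for all finite subsets $F\subseteq A$ with a $\mathfrak{c}$-sup. Then (1) $\Leftrightarrow$ (2) $\Leftrightarrow$ (3) $\Leftrightarrow$ (4) $\Rightarrow$ (5) $\Rightarrow$ (7), and (4) $\Rightarrow$ (6) $\Rightarrow$ (7). Moreover: - if $\mathfrak{c}$ separates points, then (5) $\Rightarrow$ (4) and (7) $\Rightarrow$ (6); - if $\mathfrak{c}$ is finitary, then (6) $\Rightarrow$ (4); - if $\mathfrak{c}$ separates points and is finitary, then all conditions are equivalent.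
   Context: A qoset $(E,\leqslant)$ is a set with a reflexive transitive relation; $x\sim y$ means $x\leqslant y$ and $y\leqslant x$; $[x]$ is the $\sim$-class of $x$ and $[A]=\bigcup_{a\in A}[a]$. $\downarrow A=\{x:\exists a\in A,\,x\leqslant a\}$, $\uparrow A=\{x:\exists a\in A,\,a\leqslant x\}$, $\downarrow x=\downarrow\{x\}$; $U$ is an upper subset if $\uparrow U=U$. $B^{\uparrow}$ is the set of upper bounds of $B$, and $B^{\vee}$ is the set of all suprema (least upper bounds) of $B$ in $E$. A preclosure operator on $E$ is a map $\mathfrak{c}:2^E\to2^E$ with $A\subseteq\mathfrak{c}(A)\subseteq\mathfrak{c}(B)$ whenever $A\subseteq B$; $A$ is $\mathfrak{c}$-closed if $\mathfrak{c}(A)=A$; $\mathfrak{c}$ is finitary if $\mathfrak{c}(A)=\bigcup\{\mathfrak{c}(F):F\subseteq A\text{ finite}\}$ for all $A$. An enriched qoset $(E,\leqslant,\mathfrak{c})$ is a qoset with a preclosure operator such that $\downarrow\mathfrak{c}(A)=\mathfrak{c}(A)$ for all $A\subseteq E$. The preclosure operator $\mathfrak{c}^{\uparrow}$ is defined by $\mathfrak{c}^{\uparrow}(A)=\bigcap_{B\subseteq E}\big(\mathfrak{c}(A\cap B)\cup\uparrow(A\setminus B)\big)$. For a preclosure operator $\mathfrak{t}$ and $A\subseteq E$, a $\mathfrak{t}$-extreme point of $A$ is an $x\in A$ with $x\notin\mathfrak{t}(A\setminus[x])$; their set is $\mathrm{ex}_{\mathfrak{t}}A$. $\mathfrak{c}$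 separates points if, whenever $x\not\leqslant y$, there is a $\mathfrak{c}$-closed $V$ with $y\in V$ and $x\notin V$. A subset $B$ has a $\mathfrak{c}$-sup if $B$ has a supremum in $E$ that belongs to $\mathfrak{c}(B)$. *)

(* Defs.v *)
From mathcomp Require Import all_boot all_order.
From mathcomp Require Import boolp classical_sets cardinality.

Set Implicit Arguments.
Unset Strict Implicit.
Unset Printing Implicit Defensive.

Local Open Scope classical_set_scope.

(* A qoset is a [preorderType]. The order vocabulary of [classical_sets]
   ([ubound], [supremums], [down]) requires a [porderType], where suprema are
   unique and classes are singletons, so it is restated here for preorders. *)
Section Qoset.
Context {d : Order.disp_t} {E : preorderType d}.
Implicit Types (A B U : set E) (x y : E).

Definition qequiv x y : Prop := (x <= y)%O /\ (y <= x)%O.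

Definition qclass x : set E := [set y | qequiv x y].

Definition saturation A : set E := \bigcup_(a in A) qclass a.

Definition down_set A : set E := [set x | exists2 a, A a & (x <= a)%O].

Definition up_set A : set E := [set x | exists2 a, A a & (a <= x)%O].

Definition upper_subset U : Prop := up_set U = U.

Definition upper_bounds B : set E := [set u | forall b, B b -> (b <= u)%O].

Definition suprema B : set E :=
  [set s | upper_bounds B s /\ forall u, upper_bounds B u -> (s <= u)%O].

End Qoset.

Section Preclosure.
Context {d : Order.disp_t} {E : preorderType d}.
Implicit Types (A B F V : set E) (x y : E) (c t : set E -> set E).

Definition preclosure c : Prop :=
  forall A B, A `<=` B -> A `<=` c A /\ c A `<=` c B.

Definition preclosed c A : Prop := c A = A.

Definition finitary c : Prop :=
  forall A, c A = \bigcup_(F in [set F | finite_set F /\ F `<=` A]) c F.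

Definition enriched c : Prop :=
  preclosure c /\ forall A, down_set (c A) = c A.

Definition preclosure_up c A : set E :=
  \bigcap_(B in [set: set E]) (c (A `&` B) `|` up_set (A `\` B)).

Definition extreme_points t A : set E :=
  [set x | A x /\ ~ t (A `\` qclass x) x].

Definition separates_points c : Prop :=
  forall x y, ~ (x <= y)%O -> exists V, [/\ preclosed c V, V y & ~ V x].

Definition has_csup c B : Prop := exists s, suprema B s /\ c B s.

End Preclosure.

(* Main.v *)
Require Import Defs.
From mathcomp Require Import all_boot all_order.
From mathcomp Require Import boolp classical_sets cardinality.

(** Each of the first four conditions says that [c] cannot produce [x] from the
    points of [A] lying strictly below it; the other three exclude only the ways
    of producing [x] from a finite set, or as a supremum.  Write [S] for the set
    [(A `&` down_set [set x]) `\` qclass x] of points strictly below [x].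

    For the extremality conditions: a witness [B] that [x] avoids
    [preclosure_up c (A `\` qclass x)] must contain all of [S], since a point of
    [S] outside [B] would put [x] in [up_set]; by monotonicity [c S] then misses
    [x].  The complement of the principal ideal of [x] is an upper set which
    cuts [A] down to that ideal.  Last, if [x] is extreme for [c] in [A `\` U]
    with [U] an upper set, the complement of [U] serves as such a [B].

    For the conditions on subsets: a subset of [A] that is bounded by [x] and
    has no element equivalent to [x] is a subset of [S], so [S] is the largest
    set that could violate the condition on [c B `&` upper_bounds B].

    Suprema are compared with upper bounds in [c B] by two facts.  As [c B] is a
    lower set, it contains every supremum of [B] as soon as it contains one
    ([suprema_csup]).  Conversely, if closed sets separate points, an upper
    bound [x] of [B] lying in [c B] is a supremum ([preclosure_ubound_suprema]):
    a closed set containing an upper bound [u] contains [B], hence [c B], hence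
    [x].  Finally, if [c] is finitary, membership in [c B] is witnessed by a
    finite subset of [B], which inherits all the other hypotheses on [B]. *)

Local Open Scope classical_set_scope.
Import Order.PreorderTheory.

Section EnrichedQoset.
Set Implicit Arguments.
Unset Strict Implicit.
Context {d : Order.disp_t} {E : preorderType d}.
Implicit Types (A B F U V : set E) (x y u : E) (c : set E -> set E).

Lemma preclosure_mono c A B : preclosure c -> A `<=` B -> c A `<=` c B.
Proof. by move=> hc /hc[]. Qed.

Lemma qequiv_sym x y : qequiv x y -> qequiv y x.
Proof. by case. Qed.

Lemma saturation_mono A B : A `<=` B -> saturation A `<=` saturation B.
Proof. by move=> AB x [a /AB Ba ax]; exists a. Qed.

Lemma enriched_down c A x y : enriched c -> c A y -> (x <= y)%O -> c A x.
Proof. by move=> [_ hd] cAy xy; rewrite -hd; exists y. Qed.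

Lemma suprema_csup c B x : enriched c -> has_csup c B -> suprema B x -> c B x.
Proof.
by move=> hc [s [[ubs _] cBs]] [_ lex]; apply: enriched_down hc cBs (lex _ ubs).
Qed.

(** Closed sets are lower sets, so one containing an upper bound of [B] contains
    [c B]; no closed set can therefore separate a point of [c B] from an upper
    bound of [B]. *)
Lemma preclosure_ubound_suprema c B x : enriched c -> separates_points c ->
  c B x -> upper_bounds B x -> suprema B x.
Proof.
move=> hc sep cBx ubx; split=> // u ubu; apply: contrapT => /sep[V [cV Vu]].
apply; rewrite -cV; apply: (preclosure_mono _ _ cBx); first exact: hc.1.
by move=> b /ubu bu; rewrite -cV; apply: enriched_down hc _ bu; rewrite cV.
Qed.

(** A point of [A] strictly below [x] lies in every [B] for which [x] is not
    above a point of [(A `\` qclass x) `\` B]; that is why one [B] witnessing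
    extremality for [preclosure_up c] already decides it on the ideal of [x]. *)
Lemma extreme_preclosure_up_ideal c A x : preclosure c ->
  extreme_points (preclosure_up c) A x ->
  extreme_points c (A `&` down_set [set x]) x.
Proof.
move=> hc [Ax ncx]; split; first by split=> //; exists x.
move=> cx; apply: ncx => B _.
have [|nup] := pselect (up_set ((A `\` qclass x) `\` B) x); first by right.
left; apply: (preclosure_mono hc _ cx) => y [[Ay [_ -> yx]] nxy].
split=> //; apply: contrapT => nBy.
by apply: nup; exists y.
Qed.

(** The complement of the ideal of [x] is an upper set. *)
Lemma extreme_ideal_upper c A x :
  extreme_points c (A `&` down_set [set x]) x ->
  exists U, upper_subset U /\ extreme_points c (A `\` U) x.
Proof.
move=> ex; exists (~` down_set [set x]); split; last by rewrite setDE setCK.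
apply/seteqP; split=> [y [z nz zy] [_ -> yx]|y ny]; last by exists y.
by apply: nz; exists x => //; apply: le_trans yx.
Qed.

(** The complement of [U] is the witness required by [preclosure_up]: its
    [up_set] component stays within [U], which [x] avoids. *)
Lemma extreme_upper_preclosure_up c A U x : upper_subset U ->
  extreme_points c (A `\` U) x -> extreme_points (preclosure_up c) A x.
Proof.
move=> upU [[Ax nUx] ncx]; split=> // /(_ (~` U) I)[|[a [_ /contrapT Ua] ax]].
  by rewrite -setDE setDDl setUC -setDDl.
by apply: nUx; rewrite -upU; exists a.
Qed.

(** The points of the ideal that are not equivalent to [x] form the largest
    subset of [A] bounded by [x] whose saturation misses [x]. *)
Lemma extreme_idealP c A x : preclosure c -> A x ->
  extreme_points c (A `&` down_set [set x]) x <->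
  forall B, B `<=` A -> (c B `&` upper_bounds B) x -> saturation B x.
Proof.
move=> hc Ax; split=> [[_ ncx] B BA [cBx ubx]|hB].
  apply: contrapT => nsx; apply: ncx; apply: (preclosure_mono hc _ cBx) => b Bb.
  split; first by split; [exact: BA | exists x => //; exact: ubx].
  by move=> /qequiv_sym bx; apply: nsx; exists b.
split=> [|cx]; first by split=> //; exists x.
case: (hB _ _ (conj cx _)) => [y [[]] //|y [[_ [_ -> yx]] _] //|y [_ nxy]].
by move=> /qequiv_sym.
Qed.

End EnrichedQoset.

Theorem proposition6p13 (d : Order.disp_t) (E : preorderType d)
    (c : set E -> set E) (hc : enriched c) (A : set E) (x : E) (hx : A x) :
  let P1 := extreme_points (preclosure_up c) A x in
  let P2 := exists U : set E,
      upper_subset U /\ extreme_points c (A `\` U) x in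
  let P3 := extreme_points c (A `&` down_set [set x]) x in
  let P4 := forall B : set E, B `<=` A ->
      (c B `&` upper_bounds B) x -> saturation B x in
  let P5 := forall B : set E, B `<=` A -> has_csup c B ->
      suprema B x -> saturation B x in
  let P6 := forall F : set E, finite_set F -> F `<=` A ->
      (c F `&` upper_bounds F) x -> saturation F x in
  let P7 := forall F : set E, finite_set F -> F `<=` A -> has_csup c F ->
      suprema F x -> saturation F x in
  [/\ (P1 <-> P2), (P2 <-> P3) & (P3 <-> P4)] /\
  [/\ (P4 -> P5), (P5 -> P7), (P4 -> P6) & (P6 -> P7)] /\
  (separates_points c -> (P5 -> P4) /\ (P7 -> P6)) /\
  (finitary c -> P6 -> P4) /\
  (separates_points c -> finitary c -> [<-> P1; P2; P3; P4; P5; P6; P7]).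
Proof.
move=> P1 P2 P3 P4 P5 P6 P7; have hp := hc.1.
have i13 : P1 -> P3 by exact: extreme_preclosure_up_ideal.
have i32 : P3 -> P2 by exact: extreme_ideal_upper.
have i21 : P2 -> P1.
  by move=> [U [upU exU]]; exact: extreme_upper_preclosure_up upU exU.
have e34 : P3 <-> P4 by exact: extreme_idealP.
have i45 : P4 -> P5.
  by move=> h4 B BA csB sBx; apply: h4 => //; split; [exact: suprema_csup|case: sBx].
have i57 : P5 -> P7 by move=> h5 F _; exact: h5.
have i46 : P4 -> P6 by move=> h4 F _; exact: h4.
have i67 : P6 -> P7.
  move=> h6 F finF FA csF sFx.
  by apply: h6 => //; split; [exact: suprema_csup|case: sFx].
have i54 : separates_points c -> P5 -> P4.
  move=> sep h5 B BA [cBx ubx].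
  have sBx := preclosure_ubound_suprema hc sep cBx ubx.
  by apply: h5 => //; exists x.
have i76 : separates_points c -> P7 -> P6.
  move=> sep h7 F finF FA [cFx ubx].
  have sFx := preclosure_ubound_suprema hc sep cFx ubx.
  by apply: h7 => //; exists x.
have i64 : finitary c -> P6 -> P4.
  move=> fin h6 B BA [+ ubx]; rewrite fin => -[F [finF FB] cFx].
  apply: (saturation_mono FB); apply: h6 => //; first exact: subset_trans BA.
  by split=> // b /FB; exact: ubx.
clearbody P1 P2 P3 P4 P5 P6 P7.
by do !split; tauto.
Qed.
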